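(* There is an absolute constant $C$ such that if $A\subseteq[n]$ with $|A|\ge C\sqrt n$, then $\Sigma(A)$ contains a homogeneous progression of length $n$.
   Context: $[n]=\{1,\dots,n\}$. $\Sigma(A)=\{\sum_{s\in S}s: S\subseteq A\}$ is the set of subset sums of $A$. A homogeneous progression is an arithmetic progression $a,a+d,\dots,a+kd$ whose common difference $d$ divides $a$ (and hence every term). *)

(* Defs.v *)
From mathcomp Require Import all_boot.
Set Implicit Arguments. Unset Strict Implicit. Unset Printing Implicit Defensive.

(* A finite set of naturals is represented by a duplicate-free sequence. *)
Definition subset_sum (A : seq nat) (s : nat) : Prop :=
  exists S : seq nat, subseq S A /\ \sum_(x <- S) x = s.

Definition has_homog_prog (P : nat -> Prop) (n : nat) : Prop :=
  exists a d : nat, 0 < d /\ 0 < a /\ d %| a /\ forall k, k < n -> P (a + k * d).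

(* Main.v *)
Require Import Defs.
From mathcomp Require Import all_boot all_algebra.
From mathcomp Require Import zify ring.
From Stdlib Require Import Classical.

(** Call [Y], contained in [1, l], robustly spread if deleting any [T] of its
    elements, [T] a large multiple of [s], leaves gcd 1, an element above [l / 2]
    and at least [M] elements, where [s >= l / M] and [s >= log M].  Halving [l]
    whenever this fails (dividing by a common factor or discarding the large
    elements) reaches, after few deletions, a dilate [h * Y] inside [A] with [Y]
    robustly spread; the budgets [T] sum geometrically up to a squared logarithm,
    so at least half of [A] survives.

    For such [Y] the subset sums modulo [N], [N] comparable to [s * l], grow fast.
    If [B] is the current set of sums and [Z] a set of at least [2 |B|] residues
    that are signed sums of [D] elements of [Y], then adding one suitable element
    of [Y] enlarges [B] by at least [|B| / (2 D)].  Working modulo the largest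
    element of [Y], where the Cayley graph generated by [Y] has linearly growing
    balls, gives such sets [Z] of size about [D ^ 2 * M] for [D <= s], and all
    residues for [D] about [s].  So [O(s)] elements of [Y] already have subset sums
    covering Z/N.  The sum of these elements is only [O(N)]; hence [O(1)] disjoint
    subsets of sum exactly [N] (a zero sum modulo [s * l] and pigeonhole provide
    them, after replacing [N] by a bounded multiple of [s * l]) turn the covering
    of Z/N into an interval of length [l], which the remaining elements of [Y]
    extend to length [M ^ 2 / 2 >= n]. *)

Set Implicit Arguments. Unset Strict Implicit. Unset Printing Implicit Defensive.
Import GRing.Theory.

(** * Translates, balls and growth modulo N *)

Section SumsModN.
Local Open Scope ring_scope.

(** This is the growth of [B] when [x] becomes available as a new summand. *)
Definition escape (G : finZmodType) (B : {set G}) (x : G) : nat :=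
  #|[set b in B | b + x \notin B]|.
Arguments escape {G} B%_SET x%_R.

Lemma escape0 (G : finZmodType) (B : {set G}) : escape B 0 = 0%N.
Proof.
apply/eqP; rewrite /escape cards_eq0; apply/eqP/setP => b.
by rewrite !inE addr0 andbN.
Qed.

Lemma escapeD (G : finZmodType) (B : {set G}) (x y : G) :
  (escape B (x + y) <= escape B x + escape B y)%N.
Proof.
rewrite /escape -[X in (_ <= _ + X)%N](card_imset _ (addIr (- x))).
apply: leq_trans (leq_card_setU _ _); apply/subset_leq_card/subsetP => b.
rewrite !inE => /andP[-> bxy] /=.
have [bx /=|//] := boolP (b + x \in B).
by apply/imsetP; exists (b + x); rewrite ?addrK // inE bx -addrA.
Qed.

Lemma card_stay_escape (G : finZmodType) (B : {set G}) (x : G) :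
  (#|[set b in B | (b + x)%R \in B]| + escape B x = #|B|)%N.
Proof.
rewrite -(cardsID [set b | b + x \in B] B); congr (_ + _)%N; apply: eq_card => b;
by rewrite !inE // andbC.
Qed.

Lemma escapeN (G : finZmodType) (B : {set G}) (x : G) : escape B (- x) = escape B x.
Proof.
apply/eqP; rewrite -(eqn_add2l #|[set b in B | (b + x)%R \in B]|) card_stay_escape.
suff <- : #|[set b in B | b - x \in B]| = #|[set b in B | b + x \in B]|.
  by rewrite card_stay_escape.
rewrite -[RHS](card_imset _ (addIr x)); apply: eq_card => b; rewrite !inE.
apply/andP/imsetP => [[bB bxB]|[c]].
  by exists (b - x); rewrite ?subrK // inE bxB subrK.
by rewrite inE => /andP[cB cxB] ->; rewrite addrK.
Qed.

(* The sets [B :&: (B - z)], over all [z], have total size [#|B| ^ 2], so some [z] in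
   [Z] carries at least half of [B] outside [B]. *)
Lemma exists_escape_half (G : finZmodType) (B Z : {set G}) :
  B != set0 -> (2 * #|B| <= #|Z|)%N ->
  exists2 z, z \in Z & (#|B| <= 2 * escape B z)%N.
Proof.
rewrite -card_gt0 => B0 BZ.
have [/exists_inP[z zZ hz]|/exists_inPn nz] :=
  boolP [exists z in Z, (#|B| <= 2 * escape B z)%N]; first by exists z.
have : (\sum_(z in Z) #|[set b in B | (b + z)%R \in B]| <= #|B| * #|B|)%N.
  under eq_bigr => z _ do rewrite -sum1_card.
  rewrite (exchange_big_dep (mem B)) /=; last by move=> z b _; rewrite inE => /andP[].
  rewrite -sum_nat_const; apply: leq_sum => b _; rewrite sum1_card.
  rewrite -(card_imset _ (addrI b)); apply/subset_leq_card/subsetP => _ /imsetP[z + ->].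
  by rewrite unfold_in /= inE => /andP[_ /andP[]].
have : (\sum_(z in Z) #|B|.+1 <= \sum_(z in Z) 2 * #|[set b in B | (b + z)%R \in B]|)%N.
  apply: leq_sum => z zZ; have := nz z zZ; have := card_stay_escape B z; lia.
rewrite -big_distrr sum_nat_const /=; move=> h1 h2; have h3 := leq_mul BZ (leqnn #|B|.+1).
have := leq_trans (leq_trans h3 h1) (leq_mul (leqnn 2) h2).
by rewrite -mulnA leq_pmul2l // leq_pmul2l // ltnn.
Qed.

(** Signed sums of at most [k] elements of [Y], kept in the integers so that they can be built
    modulo [q] and used modulo [N]. *)
Inductive walk (Y : seq nat) : nat -> int -> Prop :=
| Walk0 : walk Y 0 0
| WalkStay k z : walk Y k z -> walk Y k.+1 z
| WalkAdd k z y : y \in Y -> walk Y k z -> walk Y k.+1 (z + y%:Z)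
| WalkSub k z y : y \in Y -> walk Y k z -> walk Y k.+1 (z - y%:Z).

Lemma walk_leq Y k k' z : (k <= k')%N -> walk Y k z -> walk Y k' z.
Proof.
move=> /subnKC <- wz; elim: (k' - k)%N => [|d IH]; first by rewrite addn0.
by rewrite addnS; apply: WalkStay.
Qed.

Lemma walk_muln Y y k z e : y \in Y -> walk Y k z -> walk Y (k + `|e|)%N (z + e * y%:Z).
Proof.
move=> yY wz; case: e => n.
  rewrite absz_nat; elim: n => [|n IH]; first by rewrite mul0r addr0 addn0.
  have -> : z + n.+1%:Z * y%:Z = z + n%:Z * y + y%:Z by rewrite intS; ring.
  by rewrite addnS; apply: WalkAdd.
rewrite NegzE abszN absz_nat; elim: n => [|n IH].
  by rewrite mulN1r addn1; apply: WalkSub.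
have -> : z + - n.+2%:Z * y%:Z = z + - n.+1%:Z * y - y%:Z by rewrite (intS n.+1); ring.
by rewrite addnS; apply: WalkSub.
Qed.

Lemma walk_bound Y q k z : (forall y, y \in Y -> (y <= q)%N) ->
  walk Y k z -> (`|z| <= k * q)%N.
Proof.
move=> Yq; elim => {k z} [//|k z _ IH|k z y /Yq yq _ IH|k z y /Yq yq _ IH]; nia.
Qed.

(** By subadditivity, if [z] moves half of [B] out and has [D] signed terms, one term accounts for a
    [1 / D] share. *)
Lemma exists_escape_large (N : nat) (Y : seq nat) (D : nat) (B Z : {set 'Z_N}) :
  B != set0 -> (2 * #|B| <= #|Z|)%N ->
  (forall z, z \in Z -> exists2 w, walk Y D w & w%:~R = z) ->
  exists2 y, y \in Y & (#|B| <= 2 * D * escape B y%:R)%N.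
Proof.
move=> B0 BZ ZD; have [z zZ hz] := exists_escape_half B0 BZ.
have [w wD wz] := ZD z zZ.
have [/hasP[y yY hy]|/hasPn nY] :=
  boolP (has (fun y => #|B| <= 2 * D * escape B y%:R)%N Y); first by exists y.
move: B0; rewrite -card_gt0 => B0.
(* If every [y] fails, each step of a walk adds strictly less than [#|B|]; the summand [k] records
   this strictness and gives the contradiction at [k = D]. *)
have key k v : walk Y k v -> (2 * D * escape B v%:~R + k <= k * #|B|)%N.
  elim => {k v} [|k v _ IH|k v y /nY yY _ IH|k v y /nY yY _ IH].
  - by rewrite escape0 muln0.
  - lia.
  - rewrite rmorphD /= -pmulrn.
    have := leq_mul (leqnn (2 * D)) (escapeD B v%:~R y%:R); rewrite mulnDr.
    move: yY IH; rewrite -ltnNge; move: (escape B (_ + _)) (escape B _) (escape B _) #|_|.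
    by move=> a b c d; clear; lia.
  - rewrite rmorphB /= -pmulrn.
    have := leq_mul (leqnn (2 * D)) (escapeD B v%:~R (- y%:R)); rewrite mulnDr escapeN.
    move: yY IH; rewrite -ltnNge; move: (escape B (_ + _)) (escape B _) (escape B _) #|_|.
    by move=> a b c d; clear; lia.
have := key _ _ wD; rewrite wz.
case: (posnP D) => [D0|]; last first.
  move=> D0 hD; exfalso; have := leq_mul (leqnn D) hz; move: hD.
  by move: (escape B z) #|_| => a b; lia.
move: wD; rewrite D0 => wD; exfalso.
have w0 : w = 0 by inversion wD.
by move: hz; rewrite -wz w0 escape0 muln0 leqNgt B0.
Qed.

Definition coprime_family (Y : seq nat) : Prop :=
  forall p : nat, (forall y, y \in Y -> p %| y)%N -> p = 1%N.

Fixpoint ball (q : nat) (Y : seq nat) (k : nat) : {set 'Z_q} :=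
  if k is k'.+1 then
    ball q Y k' :|:
    [set z | has (fun y => (z - y%:R \in ball q Y k') || (z + y%:R \in ball q Y k')) Y]
  else [set 0].

Lemma ballS q Y k : ball q Y k \subset ball q Y k.+1.
Proof. exact: subsetUl. Qed.

Lemma ball_leq q Y k k' : (k <= k')%N -> ball q Y k \subset ball q Y k'.
Proof.
move=> /subnKC <-; elim: (k' - k)%N => [|d IH]; first by rewrite addn0.
by rewrite addnS; apply: subset_trans IH (ballS _ _ _).
Qed.

Lemma ball_add q Y k z y : y \in Y -> z \in ball q Y k -> z + y%:R \in ball q Y k.+1.
Proof.
by move=> yY zk; rewrite !inE; apply/orP; right; apply/hasP; exists y; rewrite ?addrK ?zk.
Qed.

Lemma ball_sub q Y k z y : y \in Y -> z \in ball q Y k -> z - y%:R \in ball q Y k.+1.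
Proof.
move=> yY zk; rewrite !inE; apply/orP; right; apply/hasP; exists y => //.
by rewrite subrK zk orbT.
Qed.

Lemma ball_walk q Y k (z : 'Z_q) : z \in ball q Y k -> exists2 w, walk Y k w & w%:~R = z.
Proof.
elim: k z => [|k IH] z; first by rewrite inE => /eqP->; exists 0 => //; apply: Walk0.
rewrite !inE => /orP[/IH[w wk wz]|/hasP[y yY /orP[]/IH[w wk wz]]].
- by exists w => //; apply: WalkStay.
- by exists (w + y%:Z); [apply: WalkAdd | rewrite rmorphD /= wz -pmulrn subrK].
- by exists (w - y%:Z); [apply: WalkSub | rewrite rmorphB /= wz -pmulrn addrK].
Qed.

Lemma Zp_int_eq0 q (z : int) : (1 < q)%N -> z%:~R = 0 :> 'Z_q -> (q%:Z %| z)%Z.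
Proof.
move=> q1 z0; rewrite dvdzE absz_nat.
have : `|z|%:R = 0 :> 'Z_q.
  by case: z z0 => n; rewrite ?NegzE ?abszN ?absz_nat // rmorphN /=;
     move/eqP; rewrite oppr_eq0 => /eqP.
by move/(congr1 val); rewrite /= val_Zp_nat // => /eqP.
Qed.

(** A walk reaching [v] modulo [q] ends within [k * q] of 0, so at most [k + v %/ q] steps by [q]
    itself correct it to the integer [v]. *)
Lemma walk_of_ball q Y k v : (1 < q)%N -> q \in Y -> (forall y, y \in Y -> (y <= q)%N) ->
  v%:R \in ball q Y k -> walk Y (2 * k + v %/ q)%N v.
Proof.
move=> q1 qY Yq /ball_walk[w wk wv].
have /dvdzP[e ve] : (q%:Z %| v%:Z - w)%Z.
  by apply: Zp_int_eq0 => //; rewrite rmorphB /= wv -pmulrn subrr.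
have -> : v%:Z = w + e * q%:Z by rewrite -ve; ring.
apply: walk_leq (walk_muln e qY wk).
have := walk_bound Yq wk; have := divn_eq v q; have := ltn_pmod v (ltnW q1).
move: (v %/ q)%N (v %% q)%N => a r rq va wb.
suff : (`|e| <= k + a)%N by lia.
nia.
Qed.

(** The naturals translating [W] into itself are closed under addition, and membership depends only
    on the residue modulo [q]; the least positive one divides every element of [Y]. *)
Lemma closed_coprime_full q Y (W : {set 'Z_q}) : (1 < q)%N -> coprime_family Y ->
  0 \in W -> (forall y w, y \in Y -> w \in W -> w + y%:R \in W) -> W = setT.
Proof.
move=> q1 Y1 W0 WY; pose H x := [forall w in W, w + x%:R \in W].
have HP x w : H x -> w \in W -> w + x%:R \in W by move=> /forall_inP; apply.
have HE x y : x%:R = y%:R :> 'Z_q -> H x = H y by rewrite /H => ->.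
have HD x y : H x -> H y -> H (x + y)%N.
  by move=> hx hy; apply/forall_inP => w wW; rewrite natrD addrA; apply/HP/HP.
have H0 : H 0%N by apply/forall_inP => w wW; rewrite addr0.
have HM x k : H x -> H (k * x)%N by move=> hx; elim: k => // k IH; rewrite mulSn HD.
have HY y : y \in Y -> H y by move=> yY; apply/forall_inP => w; apply: WY.
have q0 : q%:R = 0 :> 'Z_q by exact: pchar_Zp.
have exH : exists x, (0 < x)%N && H x.
  by exists q; rewrite (ltnW q1) (HE _ 0%N).
case: (ex_minnP exH) => p /andP[p0 Hp] pmin.
have p1 : p = 1%N.
  apply: Y1 => y /HY hy; rewrite /dvdn -leqn0 leqNgt; apply/negP => r0.
  have := ltn_pmod y p0; rewrite ltnNge pmin // r0 /=.
  (* Subtracting [(y %/ p) * p] is imitated by adding [q - 1] copies of it. *)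
  rewrite (HE _ (y + (y %/ p) * ((q - 1) * p))%N); first by rewrite HD // HM // HM.
  rewrite natrD !natrM natrB ?(ltnW q1) // q0 {2}(divn_eq y p) natrD natrM; ring.
apply/setP => z; rewrite inE -[z]natr_Zp -[_%:R]add0r HP //.
by rewrite -[X in H X]muln1 HM // -p1.
Qed.

Lemma natr_Zp_inj q x y : (1 < q)%N -> (x < q)%N -> (y < q)%N ->
  x%:R = y%:R :> 'Z_q -> x = y.
Proof. by move=> q1 xq yq /(congr1 val); rewrite /= !val_Zp_nat // !modn_small. Qed.

Lemma natr_Zp_inj_pos q x y : (1 < q)%N -> (0 < x <= q)%N -> (0 < y <= q)%N ->
  x%:R = y%:R :> 'Z_q -> x = y.
Proof.
move=> q1 /andP[x0 xq] /andP[y0 yq] xy.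
suff : x.-1 = y.-1 by lia.
apply: (@natr_Zp_inj q) => //; try lia.
by apply: (addIr 1); rewrite !natr1 !prednK.
Qed.

Lemma card_ball q Y i : (1 < q)%N -> uniq Y -> coprime_family Y ->
  (forall y, y \in Y -> (0 < y <= q)%N) ->
  ball q Y (3 * i) = setT \/ (i * size Y <= #|ball q Y (3 * i)|)%N.
Proof.
move=> q1 uY Y1 Yq.
have b0 k : 0 \in ball q Y k.
  by elim: k => [|k IH]; [rewrite inE | apply: (subsetP (ballS q Y k))].
elim: i => [|i [IH|IH]]; first by right.
  by left; apply/eqP; rewrite -subTset -IH; apply: ball_leq; lia.
have -> : (3 * i.+1 = (3 * i).+3)%N by lia.
set k := (3 * i)%N in IH *.
(* A ball that stops growing is stable under adding [Y], hence is everything. *)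
have [full|/subsetPn[g gk2 gk1]] := boolP (ball q Y k.+2 \subset ball q Y k.+1).
  left; apply/eqP; rewrite -subTset.
  rewrite -(@closed_coprime_full q Y (ball q Y k.+1)) //.
    by apply: ball_leq; lia.
  by move=> y w yY wk; apply/(subsetP full)/ball_add.
(* [g] is at distance exactly 3i+2 from 0, so its neighbours [S] lie in the ball of
   radius 3i+3 and avoid the one of radius 3i. *)
right; pose S := [set x in [seq g + y%:R | y <- Y]].
have cS : #|S| = size Y.
  rewrite cardsE (card_uniqP _) ?size_map // map_inj_in_uniq // => x y xY yY /addrI.
  by apply: natr_Zp_inj_pos => //; apply: Yq.
have dS : [disjoint ball q Y k & S].
  apply/pred0P => x /=; apply/negbTE/negP => /andP[xk]; rewrite inE => /mapP[y yY xE].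
  by move/negP: gk1; apply; rewrite -(addrK y%:R g) -xE ball_sub.
rewrite mulSn addnC; apply: leq_trans (leq_add IH (leqnn _)) _; rewrite -cS.
have -> : (#|ball q Y k| + #|S| = #|ball q Y k :|: S|)%N.
  by rewrite cardsU (disjoint_setI0 dS) cards0 subn0.
apply/subset_leq_card/subsetP => x; rewrite in_setU => /orP[xk|].
  by apply: subsetP xk; apply: ball_leq; lia.
by rewrite inE => /mapP[y yY ->]; apply: ball_add.
Qed.

(** * Translates with large escape for spread sets *)

Definition spread (l M : nat) (Y : seq nat) : Prop :=
  [/\ uniq Y, (M <= size Y)%N, (forall y, y \in Y -> 0 < y <= l)%N,
      coprime_family Y & exists2 x, x \in Y & (l < 2 * x)%N].

Lemma spread_max l M Y : (1 < M)%N -> spread l M Y ->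
  exists q, [/\ q \in Y, (forall y, y \in Y -> 0 < y <= q)%N, (1 < q)%N & (q <= l < 2 * q)%N].
Proof.
move=> M1 [uY MY Yl Y1 [x xY lx]].
have Yex : exists y, y \in Y by exists x.
have Yub y : y \in Y -> (y <= l)%N by move/Yl => /andP[].
case: (ex_maxnP Yex Yub) => q qY qmax.
have Yq y : y \in Y -> (0 < y <= q)%N by move=> yY; rewrite qmax // andbT; case/andP: (Yl y yY).
have xq := qmax x xY; have /andP[_ ql] := Yl q qY.
exists q; split => //; last by rewrite ql /=; lia.
rewrite ltnNge; apply/negP => q1.
have : (size Y <= size [:: 1%N])%N.
  by apply: uniq_leq_size => // y /Yq; rewrite inE; lia.
by rewrite leqNgt (leq_trans M1).
Qed.

Lemma card_Zp_full N : (1 < N)%N -> #|'Z_N| = N.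
Proof. by move=> N1; rewrite card_ord Zp_cast. Qed.

(** Here [Z] is [Y] itself and [D = 1]: its elements stay distinct modulo [N] since [l <= N]. *)
Lemma escape_large_small N l M Y (B : {set 'Z_N}) : (1 < N)%N -> (l <= N)%N ->
  spread l M Y -> B != set0 -> (2 * #|B| <= M)%N ->
  exists2 y, y \in Y & (#|B| <= 2 * escape B y%:R)%N.
Proof.
move=> N1 lN [uY MY Yl _ _] B0 BM.
pose Z : {set 'Z_N} := [set x in [seq y%:R | y <- Y]].
have [||y yY hy] := @exists_escape_large N Y 1 B Z B0; last by exists y; rewrite // -[2%N]muln1.
  apply: (leq_trans BM); apply: (leq_trans MY); rewrite cardsE (card_uniqP _) ?size_map //.
  rewrite map_inj_in_uniq // => x y /Yl xl /Yl yl; apply: natr_Zp_inj_pos => //; lia.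
move=> z; rewrite inE => /mapP[y yY ->]; exists (0 + y%:Z); first exact/WalkAdd/Walk0.
by rewrite add0r -pmulrn.
Qed.

Lemma escape_large_medium N l M s i Y (B : {set 'Z_N}) : (1 < M)%N -> (l <= s * M)%N ->
  (s * l <= N)%N -> (0 < i <= s)%N -> spread l M Y -> B != set0 ->
  (4 * s * #|B| <= i * i * l)%N ->
  exists2 y, y \in Y & (#|B| <= 2 * (7 * i) * escape B y%:R)%N.
Proof.
move=> M1 lsM slN /andP[i0 is_] sY B0 Bi; have [uY MY _ Y1 _] := sY.
have [q [qY Yq q1 /andP[ql lq]]] := spread_max M1 sY.
have iqN : (i * q <= N)%N by apply: leq_trans (leq_mul is_ ql) slN.
have N1 : (1 < N)%N by apply: leq_trans iqN; rewrite -[2%N]mul1n leq_mul.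
(* Each residue of [R] modulo [q] is lifted to [i] integers below [i * q <= N], using
   up to [i] further steps of length [q]. *)
pose R := ball q Y (3 * i).
pose f (u : 'Z_q * 'I_i) : 'Z_N := (u.1 + u.2 * q)%N%:R.
have uq (u : 'Z_q) : (u < q)%N by rewrite -[X in (_ < X)%N](Zp_cast q1).
pose Z := [set f u | u in setX R [set: 'I_i]].
have cZ : #|Z| = (#|R| * i)%N.
  rewrite card_in_imset ?cardsX ?cardsT ?card_ord // => -[a j] [b k] _ _.
  have lt_ (c : 'Z_q) (m : 'I_i) : (c + m * q < N)%N.
    apply: leq_trans iqN; have := uq c; have := ltn_ord m; nia.
  move/natr_Zp_inj; rewrite !lt_ => /(_ N1 isT isT) /= E.
  have ajE : (a = b :> nat) /\ (j = k :> nat).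
    have q0 := ltnW q1; split.
      by have /(congr1 (modn^~ q)) := E; rewrite /= ![(_ + _ * q)%N]addnC !modnMDl !modn_small.
    by have /(congr1 (divn^~ q)) := E; rewrite /= ![(_ + _ * q)%N]addnC !divnMDl //
      !divn_small ?addn0.
  by congr (_, _); apply: val_inj; case: ajE.
(* The length [7 * i] is twice the radius [3 * i], plus a quotient below [i]. *)
have [||y yY hy] := @exists_escape_large N Y (7 * i) B Z B0; last by exists y.
  have : (2 * s * #|Z| >= i * i * l)%N.
    rewrite cZ; have [RT|cR] := card_ball i q1 uY Y1 Yq.
      rewrite /R RT cardsT card_Zp_full //; nia.
    have : (i * M <= #|R|)%N by apply: leq_trans cR; rewrite leq_mul2l MY orbT.
    move: #|R| => r ir.
    have : (i * i * (s * M) <= s * (r * i))%N by nia.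
    have : (i * i * l <= i * i * (s * M))%N by rewrite leq_mul2l lsM orbT.
    lia.
  have s0 : (0 < 2 * s)%N by lia.
  move=> h; rewrite -(leq_pmul2l s0); apply: leq_trans h; apply: leq_trans Bi; lia.
move=> _ /imsetP[[r j] /setXP[rR _] ->]; exists (r + j * q)%N%:Z; last by rewrite -pmulrn.
have := @walk_of_ball q Y (3 * i) (r + j * q) q1 qY.
rewrite natrD natrM pchar_Zp // mulr0 addr0 natr_Zp => /(_ _ rR) w.
apply: walk_leq (w _); last by move=> y /Yq /andP[].
rewrite [(r + _)%N]addnC divnMDl ?(ltnW q1) // divn_small ?uq //; have := ltn_ord j; lia.
Qed.

(** Radius [3 * s] fills ['Z_q] because [q <= l <= s * M], so [Z] can be all of ['Z_N]; lifting
    costs a further [N %/ q], at most [2 * H * s] since [l < 2 * q]. *)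
Lemma escape_large_final N l M s H Y (B : {set 'Z_N}) : (1 < N)%N -> (1 < M)%N ->
  (l <= s * M)%N -> (N <= H * s * l)%N -> spread l M Y -> B != set0 ->
  (2 * #|B| <= N)%N ->
  exists2 y, y \in Y & (#|B| <= 2 * ((6 + 2 * H) * s) * escape B y%:R)%N.
Proof.
move=> N1 M1 lsM NH sY B0 BN; have [uY MY _ Y1 _] := sY.
have [q [qY Yq q1 /andP[ql lq]]] := spread_max M1 sY.
have R1 : ball q Y (3 * s) = setT.
  have [//|cR] := card_ball s q1 uY Y1 Yq.
  apply/eqP; rewrite eqEcard subsetT cardsT card_Zp_full //.
  by apply: leq_trans cR; rewrite (leq_trans ql) // (leq_trans lsM) // leq_mul2l MY orbT.
apply: (@exists_escape_large N Y _ B setT B0); first by rewrite cardsT card_Zp_full.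
move=> z _; exists (val z)%:Z; last by rewrite -pmulrn natr_Zp.
apply: walk_leq (@walk_of_ball q Y (3 * s) _ q1 qY _ _).
- have : (val z < N)%N by rewrite -[X in (_ < X)%N](Zp_cast N1) ltn_ord.
  move: (val z) => v vN.
  have : (v %/ q <= H * s * 2)%N.
    rewrite -ltnS ltn_divLR ?(ltnW q1) // mulSn -mulnA.
    apply: ltn_addl; apply: leq_trans vN (leq_trans NH _).
    by rewrite leq_mul2l (ltnW lq) orbT.
  lia.
- by move=> y /Yq /andP[].
- by rewrite R1 inE.
Qed.

(** * Growth of subset sums modulo N *)

Fixpoint sums_mod (N : nat) (U : seq nat) : {set 'Z_N} :=
  if U is x :: U' then sums_mod N U' :|: [set b + x%:R | b in sums_mod N U'] else [set 0].

Lemma card_sums_mod_cons N x U :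
  #|sums_mod N (x :: U)| = (#|sums_mod N U| + escape (sums_mod N U) x%:R)%N.
Proof.
rewrite /=; set B := sums_mod N U; set C := imset _ _.
rewrite -(cardsID B (B :|: C)) setUK; congr (_ + _)%N.
rewrite setDUl setDv set0U /escape -[RHS](card_imset _ (addIr x%:R)).
apply: eq_card => z; rewrite inE; apply/andP/imsetP => [[zB /imsetP[b bB zE]]|[b]].
  by exists b; rewrite // inE bB -zE.
by rewrite inE => /andP[bB bxB] ->; split=> //; apply: imset_f.
Qed.

Lemma sums_mod_neq0 N U : sums_mod N U != set0.
Proof.
suff h : 0 \in sums_mod N U by apply/set0Pn; exists 0.
by elim: U => [|x U IH] /=; rewrite !inE ?IH.
Qed.

Lemma sums_modP N U z : z \in sums_mod N U -> exists2 v, subset_sum U v & v%:R = z.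
Proof.
elim: U z => [|x U IH] z /=.
  by rewrite inE => /eqP->; exists 0%N => //; exists [::]; rewrite big_nil.
rewrite inE => /orP[/IH[v [S [SU Sv]] vz]|/imsetP[w /IH[v [S [SU Sv]] vw] ->]].
  by exists v => //; exists S; split=> //; apply: subseq_trans SU (subseq_cons _ _).
exists (v + x)%N; last by rewrite natrD vw.
by exists (x :: S); rewrite big_cons addnC Sv /= eqxx.
Qed.

Definition robustly_spread (T l M : nat) (Y : seq nat) : Prop :=
  forall V : seq nat, (size V <= T)%N -> spread l M [seq y <- Y | y \notin V].

Definition fresh (Y V U : seq nat) : bool :=
  uniq U && all (fun x => (x \in Y) && (x \notin V)) U.

(** [V] collects the elements spent elsewhere and [t] limits the new ones. A general predicate [P]
    on the number of sums lets one iteration scheme serve all growth phases. *)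
Definition attains (Y V : seq nat) (N t : nat) (P : nat -> Prop) : Prop :=
  exists U, [/\ fresh Y V U, (size U <= t)%N & P #|sums_mod N U|].

Section Growth.
Variables (N T l M s : nat) (Y V : seq nat).
Hypotheses (M1 : (1 < M)%N) (lsM : (l <= s * M)%N) (Ms : (M <= 2 ^ s)%N).
Hypotheses (slN : (s * l <= N)%N) (robY : robustly_spread T l M Y).

Definition improves (P Q : nat -> Prop) : Prop :=
  forall Y' (B : {set 'Z_N}), spread l M Y' -> B != set0 -> P #|B| ->
  Q #|B| \/ exists2 y, y \in Y' & Q (#|B| + escape B y%:R)%N.

Lemma attains_step t P Q : (size V + t < T)%N -> improves P Q ->
  attains Y V N t P -> attains Y V N t.+1 Q.
Proof.
move=> VT PQ [U [/andP[uU /allP aU] Ut PU]].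
have sVU : (size (V ++ U) <= T)%N by rewrite size_cat; lia.
have [QU|[y]] := PQ _ _ (robY sVU) (sums_mod_neq0 N U) PU.
  by exists U; split; rewrite ?leqW // /fresh uU; apply/allP.
rewrite mem_filter mem_cat negb_or => /andP[/andP[yV yU] yY] Qy.
exists (y :: U); split; rewrite ?card_sums_mod_cons //.
by rewrite /fresh /= yU uU yY yV; apply/allP.
Qed.

Lemma attains_iter t c (P : nat -> nat -> Prop) : (size V + t + c <= T)%N ->
  (forall c, improves (P c) (P c.+1)) ->
  attains Y V N t (P 0%N) -> attains Y V N (t + c) (P c).
Proof.
move=> + imp P0; elim: c => [|c IH] VT; first by rewrite addn0.
by rewrite addnS; apply: attains_step (imp c) (IH _); lia.
Qed.

Lemma attains_impl t (P Q : nat -> Prop) : (forall b, P b -> Q b) ->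
  attains Y V N t P -> attains Y V N t Q.
Proof. by move=> PQ [U [fU Ut /PQ]]; exists U. Qed.

Lemma spread_bounds : [/\ (0 < s)%N, (1 < l)%N & (1 < N)%N].
Proof.
have s0 : (0 < s)%N by case: s Ms => //; rewrite expn0; lia.
have sY := robY (leq0n T : size [::] <= T)%N.
have [q [qY Yq q1 /andP[ql _]]] := spread_max M1 sY.
by split=> //; [lia|nia].
Qed.

Lemma attains_small : (size V + 2 * s <= T)%N ->
  attains Y V N (2 * s) (fun b => M <= 2 * b)%N.
Proof.
move=> VT; have [s0 l1 N1] := spread_bounds.
(* Each step multiplies the size by at least 3/2, and [(9 / 4) ^ s >= 2 ^ s >= M]. *)
pose P c b := (M <= 2 * b)%N \/ (3 ^ c <= 2 ^ c * b)%N.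
apply: (@attains_impl _ (P (2 * s)%N)) => [b [//|h]|].
  have : (8 ^ s <= 4 ^ s * b)%N.
    by apply: leq_trans (_ : (9 ^ s <= _)%N); [rewrite leq_exp2r|move: h; rewrite !expnM].
  have -> : (8 ^ s = 4 ^ s * 2 ^ s)%N by rewrite -expnMn.
  rewrite leq_pmul2l ?expn_gt0 // => sb; lia.
have := @attains_iter 0 (2 * s) P; rewrite addn0 add0n; apply => //.
  move=> c Y' B sY' B0; have [MB|BM] := leqP M (2 * #|B|); first by move=> _; left; left.
  case=> [|PB]; first by rewrite leqNgt BM.
  right; have [|y yY hy] := escape_large_small N1 _ sY' B0 (ltnW BM); first by nia.
  exists y => //; right; rewrite !expnS; move: PB hy.
  move: (3 ^ c)%N (2 ^ c)%N #|B| (escape B _) => a d b e; nia.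
exists [::]; split => //; right; by rewrite !expn0 cards1.
Qed.

Lemma attains_medium i : (0 < i <= s)%N -> (size V + (2 * s + 42 * i) <= T)%N ->
  attains Y V N (2 * s + 42 * i) (fun b => i * i * l <= 16 * s * b)%N.
Proof.
have [s0 l1 N1] := spread_bounds.
elim: i => // [[|i]] IH /andP[_ is_] VT.
  have : attains Y V N (2 * s) (fun b => M <= 2 * b)%N by apply: attains_small; lia.
  case=> U [fU Us /(leq_mul (leqnn s)) MU]; exists U; split=> //; first by lia.
  rewrite mul1n mul1n; lia.
have {IH} : attains Y V N (2 * s + 42 * i.+1) (fun b => i.+1 * i.+1 * l <= 16 * s * b)%N.
  by apply: IH; lia.
have : (0 < i.+1)%N by []; move: (i.+1) is_ VT => {}i is_ VT i0 IH.
(* One step adds at least [#|B| / (14 * i)], hence [i * l / (224 * s)]; 42 steps suffice since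
   [14 * ((i + 1) ^ 2 - i ^ 2) <= 42 * i]. *)
pose P c b := (i.+1 * i.+1 * l <= 16 * s * b)%N \/
  ((14 * (i * i) + c * i) * l <= 224 * s * b)%N.
apply: (@attains_impl _ (P 42%N)) => [b [//|h]|]; first by nia.
have -> : (2 * s + 42 * i.+1 = 2 * s + 42 * i + 42)%N by lia.
apply: attains_iter; first by lia.
  move=> c Y' B sY' B0; have [iB|Bi] := leqP (i.+1 * i.+1 * l) (16 * s * #|B|).
    by move=> _; left; left.
  case=> [|PB]; first by rewrite leqNgt Bi.
  have i0s : (0 < i <= s)%N by rewrite i0 ltnW.
  (* The factor 16 in the target absorbs [(i + 1) ^ 2 <= 4 * i ^ 2]. *)
  have Bi' : (4 * s * #|B| <= i * i * l)%N.
    have : (i.+1 * i.+1 * l <= 4 * (i * i) * l)%N by rewrite leq_mul2r; apply/orP; right; nia.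
    move: Bi; move: #|B| => b; lia.
  have [y yY hy] := escape_large_medium M1 lsM slN i0s sY' B0 Bi'.
  right; exists y => //; right; move: PB hy; move: #|B| (escape B _) => b e PB hy.
  have ie : (i * l <= 224 * s * e)%N.
    have i14 : (0 < 14 * i)%N by lia.
    rewrite -(leq_pmul2l i14); have := leq_mul (leqnn (224 * s)) hy; lia.
  lia.
by apply: attains_impl IH => b h; right; lia.
Qed.

Lemma attains_large H : (N <= H * s * l)%N -> (0 < H)%N ->
  (size V + (44 + (8 * H * (12 + 4 * H) + 1)) * s <= T)%N ->
  attains Y V N ((44 + (8 * H * (12 + 4 * H) + 1)) * s) (fun b => N < 2 * b)%N.
Proof.
move=> NH H0 VT; have [s0 l1 N1] := spread_bounds.
(* One step adds at least [#|B| / (E * s)] while [#|B| >= N / (16 * H)], so [c] steps pass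
   [N / 2]. *)
pose E := (12 + 4 * H)%N; pose c := (8 * H * E * s + 1)%N.
have cs : (2 * s + 42 * s + c <= (44 + (8 * H * E + 1)) * s)%N by rewrite /c; lia.
have At : attains Y V N (2 * s + 42 * s) (fun b => s * s * l <= 16 * s * b)%N.
  by apply: attains_medium; [rewrite s0 leqnn | lia].
pose P c b := (N < 2 * b)%N \/ (N <= 16 * H * b /\ c * N <= 16 * H * E * s * b)%N.
suff [U [fU Uc PU]] : attains Y V N (2 * s + 42 * s + c) (P c).
  exists U; split=> //; first exact: leq_trans Uc cs.
  case: PU => // -[_]; rewrite ltnNge => h; apply/negP => h2.
  have := leq_mul (leqnn (8 * H * E * s)) h2; rewrite /c in h; lia.
apply: attains_iter; first by rewrite -/E in VT; lia.
  move=> c' Y' B sY' B0; have [NB|BN] := ltnP N (2 * #|B|); first by move=> _; left; left.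
  case=> [|[NB PB]]; first by rewrite ltnNge BN.
  have [y yY hy] := escape_large_final N1 M1 lsM NH sY' B0 BN.
  right; exists y => //; right; move: PB NB hy; move: #|B| (escape B _) => b e PB NB hy.
  split; first by lia.
  have : (N <= 16 * H * E * s * e)%N.
    apply: leq_trans NB _; have := leq_mul (leqnn (16 * H)) hy; rewrite /E; lia.
  lia.
apply: attains_impl At => b h; right; split; last by lia.
have sb : (s * l <= 16 * b)%N by rewrite -(leq_pmul2l s0); lia.
apply: leq_trans NH _; have := leq_mul (leqnn H) sb; lia.
Qed.

End Growth.

Lemma sums_mod_cover N (A B : {set 'Z_N}) z : (1 < N)%N ->
  (N < #|A| + #|B|)%N -> exists2 a, a \in A & z - a \in B.
Proof.
move=> N1 NAB; have inj : injective (fun b : 'Z_N => z - b).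
  by move=> b c /addrI /oppr_inj.
pose I : {set 'Z_N} := [set z - b | b in B].
have cI : #|I| = #|B| by rewrite card_imset.
have : I :&: A != set0.
  have IN : (#|I :|: A| <= N)%N by rewrite -[X in (_ <= X)%N]card_Zp_full // max_card.
  rewrite -card_gt0; have := cardsUI I A; rewrite cI.
  by move: IN NAB; move: #|_| #|_| #|_| #|_| => a b c d; clear; lia.
case/set0Pn => _ /setIP[/imsetP[b bB ->] bA]; exists (z - b) => //.
by rewrite opprB addrC subrK.
Qed.

Lemma subset_sum_cat U1 U2 a b :
  subset_sum U1 a -> subset_sum U2 b -> subset_sum (U1 ++ U2) (a + b).
Proof.
move=> [S [SU Sa]] [R [RU Rb]]; exists (S ++ R); split; first exact: cat_subseq.
by rewrite big_cat Sa Rb.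
Qed.

Lemma fresh_cat Y V U1 U2 : fresh Y V U1 -> fresh Y (V ++ U1) U2 -> fresh Y V (U1 ++ U2).
Proof.
move=> /andP[u1 a1] /andP[u2 /allP a2]; rewrite /fresh cat_uniq all_cat u1 u2 a1 /= andbT.
apply/andP; split.
  by apply/hasPn => x /a2; rewrite mem_cat negb_or => /andP[_ /andP[]].
by apply/allP => x /a2; rewrite mem_cat negb_or => /andP[-> /andP[]].
Qed.

(** Two disjoint sets of fresh elements each reach more than half of the residues, so adding one sum
    from each reaches all of them. *)
Lemma covering_sums H : (0 < H)%N -> exists2 c, (0 < c)%N &
  forall l M s T N Y V, (1 < M)%N -> (l <= s * M)%N -> (M <= 2 ^ s)%N ->
  (s * l <= N <= H * s * l)%N -> robustly_spread T l M Y -> (size V + c * s <= T)%N ->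
  exists U, [/\ fresh Y V U, (size U <= c * s)%N &
    forall v, exists2 u, subset_sum U u & u = v %[mod N]].
Proof.
move=> H0; pose d := (44 + (8 * H * (12 + 4 * H) + 1))%N.
exists (2 * d)%N; first by rewrite muln_gt0 /d.
move=> l M s T N Y V M1 lsM Ms /andP[slN NH] robY VT.
have [s0 l1 N1] := spread_bounds M1 lsM Ms slN robY.
have [|U1 [f1 s1 c1]] := attains_large M1 lsM Ms slN robY (V := V) NH H0; first by rewrite -/d; lia.
have [|U2 [f2 s2 c2]] := attains_large M1 lsM Ms slN robY (V := V ++ U1) NH H0.
  rewrite size_cat -/d; rewrite -/d in s1; lia.
exists (U1 ++ U2); split; first exact: fresh_cat.
  by rewrite size_cat; rewrite -/d in s1 s2; lia.
move=> v; have [|a] := @sums_mod_cover N (sums_mod N U1) (sums_mod N U2) v%:R N1.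
  by move: c1 c2; clear; move: #|_| #|_| => a b; lia.
case/sums_modP => a' Sa <- /sums_modP[b Sb bE]; exists (a' + b)%N; first exact: subset_sum_cat.
have : (a' + b)%N%:R = v%:R :> 'Z_N by rewrite natrD bE addrC subrK.
by move/(congr1 val); rewrite /= !val_Zp_nat.
Qed.

End SumsModN.

(** * From coverings of Z/N to intervals *)

Lemma subset_sum_leq U u l : (forall x, x \in U -> x <= l) -> subset_sum U u -> u <= size U * l.
Proof.
move=> Ul [S [SU <-]]; apply: (@leq_trans (size S * l)); last first.
  by rewrite leq_mul2r (size_subseq SU) orbT.
have : forall x, x \in S -> x <= l by move=> x /(mem_subseq SU); apply: Ul.
elim: S {SU} => [|x S IH] Sl; first by rewrite big_nil.
rewrite big_cons mulSn leq_add ?Sl ?mem_head // IH // => y yS.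
by rewrite Sl // inE yS orbT.
Qed.

Lemma subset_sum_subset A U u : uniq A -> uniq U -> {subset U <= A} ->
  subset_sum U u -> subset_sum A u.
Proof.
move=> uA uU UA [S [SU <-]]; exists [seq x <- A | x \in S]; split; first exact: filter_subseq.
apply: perm_big; apply: uniq_perm; rewrite ?filter_uniq ?(subseq_uniq SU) //.
move=> x; rewrite mem_filter; have [/(mem_subseq SU)/UA->|] := boolP (x \in S); by [].
Qed.

Lemma fresh_subseq Y V U U' : subseq U' U -> fresh Y V U -> fresh Y V U'.
Proof.
move=> UU /andP[uU /allP aU]; rewrite /fresh (subseq_uniq UU) //=.
by apply/allP => x /(mem_subseq UU)/aU.
Qed.

Lemma zero_sum_block : exists2 c, 0 < c &
  forall l M s T Y V, 1 < M -> l <= s * M -> M <= 2 ^ s ->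
  robustly_spread T l M Y -> size V + c * s <= T ->
  exists2 U, fresh Y V U /\ size U <= c * s &
    exists2 j, 0 < j <= c & subset_sum U (j * (s * l)).
Proof.
have [c c0 cover] := covering_sums (isT : 0 < 1).
exists c.+1 => // l M s T Y V M1 lsM Ms robY VT.
have [s0 l1 N1] := spread_bounds M1 lsM Ms (leqnn (s * l)) robY.
have VT0 : size V <= T by lia.
have [_ MY Yl _ [x xY _]] := robY V VT0.
have [||U [fU sU cU]] := cover l M s T (s * l) Y (V ++ [:: x]) M1 lsM Ms _ robY.
- by rewrite mul1n leqnn.
- by rewrite size_cat /=; lia.
have fxU : fresh Y V ([:: x] ++ U).
  apply: fresh_cat => //; move: xY; rewrite mem_filter /fresh /= => /andP[-> ->]; by [].
have sxU : size ([:: x] ++ U) <= c.+1 * s by rewrite /=; lia.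
exists ([:: x] ++ U) => //.
(* The target is [- x] modulo [s * l], written as a natural number. *)
have [u Uu uE] := cU (x * (s * l - 1)).
have xuU : subset_sum ([:: x] ++ U) (x + u).
  by apply: subset_sum_cat => //; exists [:: x]; rewrite big_seq1.
have : s * l %| x + u.
  rewrite /dvdn -modnDmr uE modnDmr -{1}[x]muln1 -mulnDr addnC subnK ?modnMl //.
  exact: ltnW.
case/dvdnP => j jE; exists j; last by rewrite -jE.
have x0 : 0 < x by case/andP: (Yl x xY).
have : x + u <= c.+1 * s * l.
  apply: leq_trans (subset_sum_leq (l := l) _ xuU) _; last by rewrite leq_mul2r sxU orbT.
  case/andP: fxU => _ /allP aU y /aU /andP[yY yV].
  by have /andP[] : 0 < y <= l by apply: Yl; rewrite mem_filter yV.
rewrite jE -mulnA leq_pmul2r ?(ltnW N1) // => -> ; rewrite andbT lt0n.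
by apply/eqP => j0; move: jE x0; rewrite j0; lia.
Qed.

(** A block pairs a sequence with a label [j], meant to record that [j * (s * l)] is one of its
    subset sums. *)
Definition union (bs : seq (seq nat * nat)) : seq nat := flatten [seq b.1 | b <- bs].

Lemma union_filter_subseq p bs : subseq (union (filter p bs)) (union bs).
Proof.
elim: bs => //= b bs IH; case: (p b); first exact: cat_subseq.
exact: subseq_trans IH (suffix_subseq _ _).
Qed.

Lemma pigeonhole_label K J (bs : seq (seq nat * nat)) :
  (forall b, b \in bs -> 0 < b.2 <= K) -> K * J < size bs ->
  exists2 j, 0 < j <= K & J <= size [seq b <- bs | b.2 == j].
Proof.
elim: K bs => [|K IH] bs bsK.
  by case: bs bsK => // b bs /(_ b (mem_head _ _)); lia.
have [|nJ] := leqP J (size [seq b <- bs | b.2 == K.+1]); first by exists K.+1; rewrite ?leqnn.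
move=> sz; have [||j /andP[j0 jK] jJ] := IH [seq b <- bs | b.2 != K.+1].
- by move=> b; rewrite mem_filter => /andP[bK /bsK/andP[-> ?]]; rewrite -ltnS ltn_neqAle bK.
- have := count_predC (fun b : seq nat * nat => b.2 == K.+1) bs; rewrite -!size_filter.
  rewrite (_ : filter (predC _) bs = [seq b <- bs | b.2 != K.+1]) // => szE.
  by move: sz nJ; rewrite -szE mulSn; move: (size _) (size _) => u v; clear; lia.
exists j; first by rewrite j0 (leqW jK).
apply: leq_trans jJ _; rewrite !size_filter count_filter.
by apply: sub_count => b /andP[].
Qed.

Lemma subset_sum_blocks N bs k : (forall b, b \in bs -> subset_sum b.1 N) ->
  k <= size bs -> subset_sum (union bs) (k * N).
Proof.
elim: bs k => [|b bs IH] k bsN.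
  by rewrite leqn0 => /eqP->; exists [::]; rewrite big_nil.
case: k => [|k] kbs; first by exists [::]; rewrite big_nil sub0seq.
rewrite mulSn; apply: subset_sum_cat; first by apply: bsN; rewrite mem_head.
by apply: IH => // b' b'bs; apply: bsN; rewrite inE b'bs orbT.
Qed.

(** For a suitable [N = j * (s * l)], a cover supplies [u] congruent to [v], and blocks of sum
    exactly [N] supply the difference [v - u]. *)
Lemma interval_of_sums : exists c, forall l M s T Y, 1 < M -> l <= s * M -> M <= 2 ^ s ->
  robustly_spread T l M Y -> c * s <= T ->
  exists V a, [/\ fresh Y [::] V, size V <= T, 0 < a &
    forall v, a <= v <= a + l -> subset_sum V v].
Proof.
have [K K0 block] := zero_sum_block.
have [c c0 cover] := covering_sums K0.
(* Among [R] blocks with labels at most [K], some [c.+1] share a label. *)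
have [R RE] : exists R, R = K * c.+1 + 1 by exists (K * c.+1 + 1).
exists (R * K + c) => l M s T Y M1 lsM Ms robY RT.
have [s0 l1 N1] := spread_bounds M1 lsM Ms (leqnn (s * l)) robY.
have blocks r : r <= R -> exists bs, [/\ size bs = r, fresh Y [::] (union bs),
    size (union bs) <= r * (K * s) &
    forall b, b \in bs -> 0 < b.2 <= K /\ subset_sum b.1 (b.2 * (s * l))].
  elim: r => [|r IH] rR; first by exists [::].
  have [bs [sbs fbs ubs bsP]] := IH (ltnW rR).
  have [|U [fU sU] [j jK Uj]] := block l M s T Y (union bs) M1 lsM Ms robY.
    have : r.+1 * (K * s) <= R * (K * s) by rewrite leq_mul2r rR orbT.
    by move: ubs RT; move: (size _) => u; clear; lia.
  exists (rcons bs (U, j)); rewrite /union map_rcons flatten_rcons size_rcons sbs; split => //.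
  - exact: (fresh_cat (V := [::])).
  - by rewrite size_cat -/(union bs) mulSn addnC leq_add.
  - by move=> b; rewrite mem_rcons inE => /orP[/eqP->|/bsP].
have [bs [sbs fbs ubs bsP]] := blocks R (leqnn R).
have [||j /andP[j0 jK] jc] := @pigeonhole_label K c.+1 bs.
- by move=> b /bsP[].
- by rewrite sbs RE addn1.
set bs' := filter _ _ in jc.
have fbs' : fresh Y [::] (union bs') := fresh_subseq (union_filter_subseq _ bs) fbs.
pose N := j * (s * l).
have subs : subseq (union bs') (union bs) := union_filter_subseq _ bs.
have ubs' := leq_trans (size_subseq subs) ubs.
have [||U [fU sU cU]] := cover l M s T N Y (union bs') M1 lsM Ms _ robY.
- by rewrite /N leq_pmull //= -mulnA leq_mul2r jK orbT.
- by move: ubs' RT; move: (size _) => u; clear; lia.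
have N0 : 0 < N by rewrite /N muln_gt0 j0 (ltnW N1).
exists (union bs' ++ U), (c * s * l); split.
- exact: (@fresh_cat Y [::] (union bs') U fbs' fU).
- by move: ubs' RT sU; rewrite size_cat; move: (size _) (size _) => u u'; clear; lia.
- by rewrite !muln_gt0 c0 s0 (ltnW l1).
move=> v /andP[av va]; have [u Uu uv] := cU v.
have uV : u <= v.
  apply: leq_trans av; apply: leq_trans (subset_sum_leq (l := l) _ Uu) _.
    move=> x xU; have /andP[_ /allP /(_ x xU) /andP[xY xn]] := fU.
    have [_ _ Yl _ _] := robY [::] (leq0n T).
    by have /andP[] : 0 < x <= l by apply: Yl; rewrite mem_filter.
  by rewrite leq_mul2r sU orbT.
have /dvdnP[k vk] : N %| v - u by rewrite -eqn_mod_dvd // uv.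
rewrite -(subnK uV) vk; apply: subset_sum_cat Uu; apply: subset_sum_blocks => [b|].
  by rewrite mem_filter => /andP[/eqP bj /bsP[_]]; rewrite bj.
(* No more than [c.+1] blocks are used: [v - u <= c * s * l + l <= c.+1 * (s * l)] and
   [s * l <= N]. *)
apply: leq_trans jc; rewrite -(leq_pmul2r (ltnW N1)).
have : k * (s * l) <= k * N by rewrite leq_mul2l /N leq_pmull ?orbT.
have : l <= s * l by rewrite leq_pmull.
lia.
Qed.

(** A summand of size at most [L] translates the interval to one that meets it. *)
Lemma interval_extend V l Z a L : (forall x, x \in Z -> x <= l) -> l <= L ->
  (forall v, a <= v <= a + L -> subset_sum V v) ->
  forall v, a <= v <= a + L + \sum_(x <- Z) x -> subset_sum (Z ++ V) v.
Proof.
move=> + lL VL; elim: Z => [|z Z IH] Zl v; first by rewrite big_nil addn0; apply: VL.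
rewrite big_cons => /andP[av va].
have {}IH := IH (fun x xZ => Zl x (mem_behead (s := z :: Z) xZ)).
have [vs|vs] := leqP v (a + L + \sum_(x <- Z) x).
  have [S [SU Sv]] := IH v (introT andP (conj av vs)).
  by exists S; split=> //; apply: subseq_trans SU (subseq_cons _ _).
have zl := Zl z (mem_head _ _).
have -> : v = z + (v - z) by lia.
rewrite -cat1s -catA; apply: subset_sum_cat; first by exists [:: z]; rewrite big_seq1.
apply: IH; lia.
Qed.

Lemma sum_uniq_pos (Z : seq nat) : uniq Z -> (forall x, x \in Z -> 0 < x) ->
  size Z * size Z <= 2 * \sum_(x <- Z) x.
Proof.
move: {2}(size Z) (erefl (size Z)) => m; elim: m Z => [|m IH] Z sZ uZ Z0; first by rewrite sZ.
have [x xZ mx] : exists2 x, x \in Z & m < x.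
  have [/hasP[x]|/hasPn Zm] := boolP (has (fun x => m < x) Z); first by exists x.
  suff : size Z <= size (iota 1 m) by rewrite sZ size_iota ltnn.
  apply: uniq_leq_size => // x xZ; rewrite mem_iota Z0 //= add1n ltnS leqNgt.
  exact: Zm.
have pZ := perm_to_rem xZ; rewrite (perm_big _ pZ) big_cons sZ /=.
have sr : size (rem x Z) = m by rewrite size_rem // sZ.
have := IH _ sr (rem_uniq _ uZ) (fun y yZ => Z0 y (mem_rem yZ)); rewrite sr; lia.
Qed.

(** By robustness at least [M] elements of [Y] lie outside [V]; being distinct and positive, they
    lengthen the interval by at least [M * M / 2]. *)
Lemma spread_interval : exists c, forall l M s T Y, 1 < M -> l <= s * M -> M <= 2 ^ s ->
  robustly_spread T l M Y -> c * s <= T ->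
  exists W a, [/\ uniq W, {subset W <= Y}, 0 < a &
    forall v, a <= v -> 2 * v <= 2 * a + M * M -> subset_sum W v].
Proof.
have [c hc] := interval_of_sums; exists c => l M s T Y M1 lsM Ms robY cT.
have [V [a [/andP[uV /allP VY] VT a0 Vv]]] := hc l M s T Y M1 lsM Ms robY cT.
have [uZ MZ Zl _ _] := robY V VT; set Z := filter _ _ in uZ MZ Zl.
exists (Z ++ V), a; split => //.
- rewrite cat_uniq uZ uV andbT; apply/hasPn => x xV.
  by rewrite mem_filter xV.
- by move=> x; rewrite mem_cat mem_filter => /orP[/andP[]|/VY/andP[]].
move=> v av va; apply: (interval_extend (l := l) _ (leqnn l) Vv).
  by move=> x /Zl /andP[].
have := leq_trans (leq_mul MZ MZ) (sum_uniq_pos uZ (fun x xZ => proj1 (andP (Zl x xZ)))).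
by move: av va; move: (\sum_(x <- Z) x) => S; clear; lia.
Qed.

(** * Extraction of a robustly spread set *)

Lemma size_filter_notin (Y V : seq nat) : uniq Y ->
  size Y <= size [seq y <- Y | y \notin V] + size V.
Proof.
move=> uY; rewrite -size_cat; apply: uniq_leq_size => // y yY.
by rewrite mem_cat mem_filter yY andbT; case: (y \in V).
Qed.

(** After deleting a bad [V], either the gcd condition fails and [h] gains a common factor, or no
    large element is left and [h = g]; the range relative to the dilation halves. *)
Lemma not_robust_halve (M T g l : nat) (X : seq nat) :
  uniq X -> 0 < g -> (forall x, x \in X -> [&& 0 < x, g %| x & x <= g * l]) ->
  M + T <= size X -> ~ robustly_spread T l M [seq x %/ g | x <- X] ->
  exists h X', [/\ 0 < h, uniq X', {subset X' <= X}, size X <= size X' + T &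
    forall x, x \in X' -> [&& 0 < x, h %| x & 2 * x <= h * l]].
Proof.
move=> uX g0 Xg sX nr; set Y := map _ _ in nr.
have XY y : y \in Y -> g * y \in X /\ 0 < y <= l.
  case/mapP => x xX ->; have /and3P[x0 gx xl] := Xg x xX.
  by rewrite mulnC divnK // xX divn_gt0 // dvdn_leq // -(leq_pmul2l g0) mulnC divnK.
have uY : uniq Y.
  rewrite map_inj_in_uniq // => x x' /Xg/and3P[_ gx _] /Xg/and3P[_ gx' _] E.
  by rewrite -(divnK gx) E divnK.
have [V nVT] := not_all_ex_not _ _ nr; have [VT nV] := imply_to_and _ _ nVT.
pose Y' := [seq y <- Y | y \notin V].
have Y'Y y : y \in Y' -> y \in Y by rewrite mem_filter => /andP[].
have sY' : size Y <= size Y' + T.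
  by apply: leq_trans (size_filter_notin V uY) _; rewrite leq_add2l.
rewrite size_map in sY'.
have [h [h0 hY']] : exists h, 0 < h /\
    forall y, y \in Y' -> h %| g * y /\ 2 * (g * y) <= h * l.
  apply: NNPP => nh; apply: nV; split; rewrite ?filter_uniq //.
  - by rewrite -/Y' -(leq_add2r T); apply: leq_trans sX sY'.
  - by move=> y /Y'Y /XY[].
  - move=> p pY'; apply: NNPP => p1; apply: (nh); exists (g * p).
    (* [p = 0] would force [Y'] to be empty, and then [h = g] works vacuously. *)
    have [p0|p0] := posnP p.
      case: nh; exists g; split => // y yY'; move: (pY' y yY').
      by rewrite p0 dvd0n => /eqP y0; have [_] := XY y (Y'Y y yY'); rewrite y0.
    rewrite muln_gt0 g0 p0; split => // y yY'; have [_ /andP[_ yl]] := XY y (Y'Y y yY').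
    rewrite dvdn_pmul2l // (pY' y yY'); split => //.
    by rewrite mulnCA -mulnA leq_pmul2l // leq_mul //; lia.
  - apply: NNPP => ny; apply: nh; exists g; split => // y yY'; rewrite dvdn_mulr //; split => //.
    rewrite mulnCA leq_pmul2l // leqNgt; apply/negP => yl; apply: ny; by exists y.
exists h, [seq g * y | y <- Y']; split => //.
- rewrite map_inj_uniq ?filter_uniq // => y z /eqP; rewrite eqn_pmul2l //; exact: eqP.
- by move=> _ /mapP[y /Y'Y /XY[gy _] ->].
- by rewrite size_map.
move=> _ /mapP[y yY' ->]; have [-> ->] := hY' y yY'.
by have [_ /andP[y0 _]] := XY y (Y'Y y yY'); rewrite muln_gt0 g0 y0.
Qed.

(** A failure at scale [2 ^ j] costs at most [T j] elements and lowers [j], so the sum of the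
    budgets covers all losses. *)
Lemma robust_subset (M : nat) (T : nat -> nat) (j g : nat) (X : seq nat) :
  0 < M -> uniq X -> 0 < g -> (forall x, x \in X -> [&& 0 < x, g %| x & x <= g * 2 ^ j]) ->
  M + \sum_(i < j.+1) T i <= size X ->
  exists2 i, i <= j & exists h Y, [/\ 0 < h, {subset [seq h * y | y <- Y] <= X} &
    robustly_spread (T i) (2 ^ i) M Y].
Proof.
move=> M0; elim/ltn_ind: j g X => j IH g X uX g0 Xg; rewrite big_ord_recr /= => sX.
have [rob|nrob] := classic (robustly_spread (T j) (2 ^ j) M [seq x %/ g | x <- X]).
  exists j => //; exists g, [seq x %/ g | x <- X]; split => // _ /mapP[_ /mapP[x xX ->] ->].
  by have /and3P[_ gx _] := Xg x xX; rewrite mulnC divnK.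
have MT : M + T j <= size X by lia.
have [h [X' [h0 uX' X'X sX' X'h]]] := not_robust_halve uX g0 Xg MT nrob.
(* At [j = 0] the budget keeps [X'] nonempty, yet a member would be a positive multiple of [h] with
   [2 * x <= h]. *)
case: j => [|j] in IH Xg sX MT nrob sX' X'h *.
  have [x xX'] : exists x, x \in X'.
    case: X' sX' {uX' X'X X'h} => [|x X'] sX'; last by exists x; rewrite mem_head.
    by move: sX MT => /=; rewrite big_ord0; move: sX' => /=; lia.
  have /and3P[x0 hx xh] := X'h x xX'; have := dvdn_leq x0 hx; lia.
have [||i ij [h' [Y [h'0 YX' rob]]]] := IH j (ltnSn j) h X' uX' h0.
- by move=> x /X'h/and3P[-> -> /=]; rewrite expnS mulnCA leq_pmul2l.
- by rewrite -(leq_add2r (T j.+1)) -addnA (leq_trans sX sX').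
exists i; first exact: leqW; exists h', Y; split => // x /YX'; exact: X'X.
Qed.

(** * Size of the deletion budget, and conclusion *)

Lemma expn4_le_exp2 j : j.+1 ^ 4 <= 4 ^ 4 * 2 ^ j.
Proof.
have h : j.+1 <= 4 * 2 ^ (j %/ 4).
  apply: (@leq_trans (4 * (j %/ 4).+1)); last by rewrite leq_pmul2l // ltn_expl.
  by have := divn_eq j 4; have := ltn_pmod j (isT : 0 < 4); lia.
have : j.+1 ^ 4 <= (4 * 2 ^ (j %/ 4)) ^ 4 by rewrite leq_exp2r.
move=> h4; apply: leq_trans h4 _; rewrite expnMn -expnM leq_pmul2l ?expn_gt0 //.
by rewrite leq_exp2l // leq_divM.
Qed.

Lemma subset_sum_muln h W v : subset_sum W v -> subset_sum [seq h * x | x <- W] (h * v).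
Proof.
move=> [S [SW <-]]; exists [seq h * x | x <- S]; split; first exact: map_subseq.
by rewrite big_map -big_distrr.
Qed.

Lemma sum_pow2 j : \sum_(i < j) 2 ^ i < 2 ^ j.
Proof.
elim: j => [|j IH]; first by rewrite big_ord0.
by rewrite big_ord_recr expnS /= mul2n -addnn -addSn leq_add2r.
Qed.

Lemma up_log2_le n : 0 < n -> 2 ^ up_log 2 n <= 2 * n.
Proof.
case: n => [|[|n]] // _; have /andP[] := @up_log_bounds 2 n.+2 isT isT.
have : 0 < up_log 2 n.+2 by rewrite up_log_gt0.
by case: (up_log 2 n.+2) => // k _ /= + _; rewrite expnS leq_pmul2l // => /ltnW.
Qed.

(** The quotients sum geometrically to at most [4 * n / M]; the rest is [(J + 1) ^ 2], compared with
    [M] after squaring, since [(J + 1) ^ 4] is [O(n)]. *)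
Lemma budget_bound c n J M : 0 < M -> 2 ^ J <= 2 * n ->
  (100 * (4 ^ 4 * c.+1)) ^ 2 * n <= 9 * (M * M) ->
  \sum_(i < J.+1) c * (2 ^ i %/ M + J.+1) <= M.
Proof.
move=> M0 Jn CM; rewrite -big_distrr /= big_split /= sum_nat_const card_ord.
have s1 : M * (\sum_(i < J.+1) 2 ^ i %/ M) <= 4 * n.
  rewrite big_distrr /=; apply: (@leq_trans (\sum_(i < J.+1) 2 ^ i)).
    by apply: leq_sum => i _; rewrite mulnC leq_divM.
  by have := sum_pow2 J.+1; rewrite expnS; lia.
have J4 := expn4_le_exp2 J.
have D0 : 1 <= 4 ^ 4 by rewrite expn_gt0.
move: (4 ^ 4) D0 CM J4 => D D0 CM J4; set C := 100 * _ in CM.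
(* The size of [C] enters twice: [72 * c <= C] settles the geometric part, and
   [72 * c * (D * c) <= C ^ 2] the logarithmic one. *)
have Cc : 72 * c <= C by rewrite /C; nia.
have CD : D * c <= C by rewrite /C; nia.
have c8 : 8 * c * n <= M * M.
  have : 72 * c * n <= 9 * (M * M).
    by apply: leq_trans CM; rewrite leq_mul2r -mulnn (leq_trans Cc) ?orbT // leq_pmulr //
      /C !muln_gt0 D0.
  by move: (M * M) => m; lia.
have J2 : 2 * c * (J.+1 * J.+1) <= M.
  rewrite -leq_sqr -(@leq_pmul2l 9) // -[in X in _ <= X]mulnn; apply: leq_trans CM.
  have -> : 9 * (2 * c * (J.+1 * J.+1)) ^ 2 = 36 * c * c * J.+1 ^ 4 by ring.
  have := leq_mul (leqnn (36 * c * c)) (leq_trans J4 (leq_mul (leqnn D) Jn)).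
  have := leq_mul (leq_mul Cc CD) (leqnn n); rewrite -mulnn; lia.
rewrite -(leq_pmul2l M0); move: (\sum_(i < J.+1) _) s1 => S s1.
have := leq_mul (leqnn c) s1; have := leq_mul (leqnn M) J2; lia.
Qed.

Theorem theorem1p9 :
  exists C : nat, forall (n : nat) (A : seq nat),
    uniq A -> all (fun x => (1 <= x <= n)%N) A ->
    (C ^ 2 * n <= (size A) ^ 2)%N ->
    has_homog_prog (subset_sum A) n.
Proof.
have [c interval] := spread_interval.
exists (100 * (4 ^ 4 * c.+1)) => n A uA /allP An Cn.
have [n0|n0] := posnP n; first by exists 1, 1; rewrite n0.
have An_le : size A <= n.
  rewrite -(size_iota 1 n); apply: uniq_leq_size => // x /An.
  by rewrite mem_iota add1n ltnS.
set C := 100 * _ in Cn.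
have C100 : 100 <= C by rewrite leq_pmulr // muln_gt0 expn_gt0.
have A100 : 100 <= size A.
  rewrite -leq_sqr; apply: leq_trans Cn; rewrite -[X in X <= _]muln1.
  by apply: leq_mul => //; rewrite leq_sqr.
(* One half of [A] pays for the deletions, the other survives; [2 ^ J] is the initial range. *)
pose M := (size A)./2; pose J := up_log 2 n.
have MA : 2 * M <= size A <= 3 * M.
  by rewrite /M; have := odd_double_half (size A); rewrite -muln2; case: odd; lia.
have /andP[MA2 MA3] := MA; have M1 : 1 < M by lia.
have CM : C ^ 2 * n <= 9 * (M * M).
  by apply: leq_trans Cn _; have := leq_mul MA3 MA3; rewrite -mulnn; lia.
have nJ : n <= 2 ^ J by apply: up_logP.
(* The quotient, with [J.+1] covering the remainder, gives [2 ^ i <= s i * M]; [J.+1] also gives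
   [M <= 2 ^ s i], as [M <= n <= 2 ^ J]. *)
pose s i := 2 ^ i %/ M + J.+1.
have budget := budget_bound (ltnW M1) (up_log2_le n0) CM.
have [|||i iJ [h [Y [h0 YA robY]]]] :=
    @robust_subset M (fun i => c * s i) J 1 A (ltnW M1) uA.
- by [].
- by move=> x /An /andP[-> xn]; rewrite dvd1n mul1n (leq_trans xn nJ).
- apply: leq_trans MA2; rewrite mul2n -addnn leq_add2l; exact: budget.
have [||W [a [uW WY a0 Wv]]] := interval (2 ^ i) M (s i) (c * s i) Y M1 _ _ robY (leqnn _).
- by rewrite /s mulnDl; have := divn_eq (2 ^ i) M; have := ltn_pmod (2 ^ i) (ltnW M1); nia.
- apply: (@leq_trans (2 ^ J)); first by apply: leq_trans nJ; lia.
  by rewrite leq_exp2l // /s (leq_trans (leqnSn J)) // leq_addl.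
exists (h * a), h; rewrite h0 muln_gt0 h0 a0 dvdn_mulr //; do 3!split => //.
move=> k kn; rewrite [k * h]mulnC -mulnDr.
apply: (@subset_sum_subset _ [seq h * x | x <- W]) => //.
- by rewrite map_inj_uniq // => x y /eqP; rewrite eqn_pmul2l // => /eqP.
- by move=> _ /mapP[x /WY xY ->]; apply: YA; apply: map_f.
apply: subset_sum_muln; apply: Wv; first exact: leq_addr.
(* Dividing by 9 leaves [2 * n <= M * M], so every offset [k < n] stays in the interval. *)
have : 18 * n <= 9 * (M * M).
  apply: leq_trans CM; rewrite leq_mul2r; apply/orP; right.
  by apply: (@leq_trans (100 ^ 2)); rewrite ?leq_sqr.
lia.
Qed.
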